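(* Let $n\geq 2$ and let $\gamma:I\to\mathbb{R}^n$ be a parametrized curve of order $n-1$, with canonical matrix $A(t)=[\gamma'(t)\,|\,\gamma''(t)\,|\cdots|\,\gamma^{(n)}(t)]$ and generalized curvatures $\kappa_1(t),\ldots,\kappa_{n-1}(t)$. For $1\leq i\leq n$, let $M_i(t)$ be the $i\times i$ matrix whose $(j,k)$ entry is $\langle\gamma^{(j)}(t),\gamma^{(k)}(t)\rangle$, $1\le j,k\le i$, and put $\det M_0(t)=1$. Then for all $t\in I$: (1) if $n\geq 3$, $$\kappa_1(t)=\frac{\sqrt{\det M_2(t)}}{\Vert\gamma'(t)\Vert^3};$$ (2) for $2\leq i\leq n-2$, $$\kappa_i(t)=\frac{\sqrt{\det M_{i+1}(t)\,\det M_{i-1}(t)}}{\Vert\gamma'(t)\Vert\,\det M_i(t)};$$ (3) for $n\geq 2$, $$\kappa_{n-1}(t)=\frac{\det A(t)}{\Vert\gamma'(t)\Vert\,\det M_{n-1}(t)}\sqrt{\det M_{n-2}(t)}.$$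
   Context: $\langle\cdot,\cdot\rangle$ and $\Vert\cdot\Vert$ are the Euclidean inner product and norm on $\mathbb{R}^n$. A parametrized curve in $\mathbb{R}^n$ is a smooth ($C^\infty$) function $\gamma:I\to\mathbb{R}^n$ on an open interval $I$ with $\gamma'(t)\neq 0$ for all $t\in I$. It has order $k$ (is regular of order $k$) if $\gamma'(t),\ldots,\gamma^{(k)}(t)$ are linearly independent for every $t\in I$. Generalized cross product: for $v_1,\ldots,v_{n-1}\in\mathbb{R}^n$, $\mathscr{P}(v_1,\ldots,v_{n-1})\in\mathbb{R}^n$ is the formal determinant of the $n\times n$ array with first $n-1$ columns $v_1,\ldots,v_{n-1}$ and last column $(e_1,\ldots,e_n)^T$ (standard unit vectors), expanded along the last column; equivalently, it is the unique vector with $\langle\mathscr{P}(v_1,\ldots,v_{n-1}),w\rangle=\det[v_1|\cdots|v_{n-1}|w]$ for all $w\in\mathbb{R}^n$. Frenet frame: for a curve of order $n-1$ ($n\ge2$), $T(t),N_1(t),\ldots,N_{n-2}(t)$ are the orthonormal vectors obtained by applying the Gram-Schmidt process (with normalization, so that the inner product of the $j$-th output vector with the $j$-th input vector is positive) to $\gamma'(t),\ldots,\gamma^{(n-1)}(t)$, and $N_{n-1}(t)=\mathscr{P}(T(t),N_1(t),\ldots,N_{n-2}(t))$. Generalized curvatures: if $\gamma$ is parametrized by arclength $s$ (i.e. $\Vert\gamma'(s)\Vert=1$) and has order $n-1$, then $\kappa_1(s)=\langle T'(s),N_1(s)\rangle$ and $\kappa_i(s)=\langle N_{i-1}'(s),N_i(s)\rangle$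 for $2\leq i\leq n-1$. For a general parametrization, let $s(t)=\int_{t_0}^t\Vert\gamma'(\tau)\Vert\,d\tau$ (for a fixed $t_0\in I$) and let $\tilde\gamma=\gamma\circ s^{-1}$ be the arclength reparametrization, with curvatures $\tilde\kappa_i$; then the generalized curvatures of $\gamma$ are $\kappa_i(t)=\tilde\kappa_i(s(t))$. *)

(* Defs.v *)
From HB Require Import structures.
From mathcomp Require Import all_boot all_order all_algebra.
From mathcomp Require Import all_classical all_reals all_analysis.

Set Implicit Arguments.
Unset Strict Implicit.
Unset Printing Implicit Defensive.

Import Order.TTheory GRing.Theory Num.Theory.
Import numFieldNormedType.Exports.

Local Open Scope classical_set_scope.
Local Open Scope ring_scope.

(* The library norm `|u| on 'cV[R]_n is the sup norm, which has the same
   topology (hence the same derivatives) as enorm. *)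
Definition dot (R : realType) (n : nat) (u v : 'cV[R]_n) : R :=
  \sum_(i < n) u i 0 * v i 0.

Definition enorm (R : realType) (n : nat) (u : 'cV[R]_n) : R :=
  Num.sqrt (dot u u).

(* A curve is a total function, used only on the open interval I: all the
   iterated derivatives derive1n k g at a point of I depend on g on I only. *)
Definition parametrized_curve (R : realType) (n : nat) (I : set R)
    (g : R -> 'cV[R]_n) : Prop :=
  [/\ open I, is_interval I,
      forall (k : nat) (t : R), I t -> derivable (derive1n k g) t 1
    & forall t : R, I t -> derive1 g t != 0].

Definition has_order (R : realType) (n : nat) (I : set R)
    (g : R -> 'cV[R]_n) (k : nat) : Prop :=
  forall t : R, I t -> free (mkseq (fun j => derive1n j.+1 g t) k).

(* The determinant of [V | (e_1, ..., e_n)^T] expanded along its last column: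
   the coefficient of e_i is the signed minor of V without row i (indices
   are counted from 0, so the last column is the column n.-1). *)
Definition cross (R : realType) (n : nat) (V : 'M[R]_(n, n.-1)) : 'cV[R]_n :=
  \col_(i < n) ((-1) ^+ (i + n.-1) * \det (row' i V)).

Fixpoint gram_schmidt_seq (R : realType) (n : nat) (v : nat -> 'cV[R]_n)
    (k : nat) : seq 'cV[R]_n :=
  if k is k'.+1 then
    let e := gram_schmidt_seq v k' in
    let u := v k' - \sum_(w <- e) dot (v k') w *: w in
    rcons e ((enorm u)^-1 *: u)
  else [::].

Definition gram_schmidt (R : realType) (n : nat) (v : nat -> 'cV[R]_n)
    (j : nat) : 'cV[R]_n :=
  nth 0 (gram_schmidt_seq v j.+1) j.

(* frenet g 0 = T and frenet g j = N_j for 1 <= j <= n.-1. *)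
Definition frenet (R : realType) (n : nat) (g : R -> 'cV[R]_n) (j : nat)
    (t : R) : 'cV[R]_n :=
  let e := gram_schmidt (fun k => derive1n k.+1 g t) in
  if (j < n.-1)%N then e j else cross (\matrix_(r, c) e c r 0).

(* Curvatures of an arclength parametrization, 1 <= i <= n.-1. *)
Definition curvature_arclength (R : realType) (n : nat) (g : R -> 'cV[R]_n)
    (i : nat) (s : R) : R :=
  dot (derive1 (frenet g i.-1) s) (frenet g i s).

(* The oriented integral of enorm g' from t0 to t. *)
Definition arclength (R : realType) (n : nat) (g : R -> 'cV[R]_n)
    (t0 t : R) : R :=
  if t0 <= t then \int[lebesgue_measure]_(x in `[t0, t]) enorm (derive1 g x)
  else - \int[lebesgue_measure]_(x in `[t, t0]) enorm (derive1 g x).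

(* The inverse is that of the restriction of the arclength to I; its value
   outside of the open interval arclength g t0 @` I is irrelevant. *)
Definition arclength_reparam (R : realType) (n : nat) (I : set R)
    (g : R -> 'cV[R]_n) (t0 : R) : R -> 'cV[R]_n :=
  g \o 'pinv_(fun=> t0) I (arclength g t0).

Definition curvature (R : realType) (n : nat) (I : set R)
    (g : R -> 'cV[R]_n) (t0 : R) (i : nat) (t : R) : R :=
  curvature_arclength (arclength_reparam I g t0) i (arclength g t0 t).

Definition canonical_mx (R : realType) (n : nat) (g : R -> 'cV[R]_n)
    (t : R) : 'M[R]_n :=
  \matrix_(r < n, c < n) derive1n c.+1 g t r 0.

(* For i = 0 this is the empty matrix, whose determinant is 1. *)
Definition gram_mx (R : realType) (n : nat) (g : R -> 'cV[R]_n) (i : nat)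
    (t : R) : 'M[R]_i :=
  \matrix_(j < i, k < i) dot (derive1n j.+1 g t) (derive1n k.+1 g t).

(* Main.v *)
Require Import Defs.
From mathcomp Require Import all_boot all_order all_algebra.
From mathcomp Require Import ring.
From mathcomp Require Import all_classical all_reals all_analysis.
Import Order.TTheory GRing.Theory Num.Theory.
Import numFieldNormedType.Exports.

Local Open Scope classical_set_scope.
Local Open Scope ring_scope.

(** Write v_j = g^(j), let e_1, ..., e_n be the Frenet vectors and
    r_j = <v_j, e_j>. The k-th arclength derivative of the curve is a
    combination of v_1, ..., v_k in which v_k has the coefficient
    ||g'||^(-k) > 0, so the Frenet frame does not depend on the
    parametrization, and kappa_i = <e_i', e_(i+1)> / ||g'||. Differentiating
    v_i = sum_(k <= i) <v_i, e_k> e_k and pairing with e_(i+1), which is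
    orthogonal to v_1, ..., v_i, gives r_i <e_i', e_(i+1)> = r_(i+1), hence
    kappa_i = r_(i+1) / (||g'|| r_i). Finally the triangular factorizations of
    the Gram matrices and of A give det M_i = (r_1 ... r_i)^2 for i < n and
    det A = r_1 ... r_n. *)

(** * Gram-Schmidt and the generalized cross product *)

Lemma dotC {R : realType} {n : nat} (u v : 'cV[R]_n) : dot u v = dot v u.
Proof. by apply: eq_bigr => i _; rewrite mulrC. Qed.

Lemma dotDl {R : realType} {n : nat} (u v w : 'cV[R]_n) :
  dot (u + v) w = dot u w + dot v w.
Proof.
by rewrite -big_split; apply: eq_bigr => i _; rewrite mxE mulrDl.
Qed.

Lemma dotZl {R : realType} {n : nat} (a : R) (u w : 'cV[R]_n) :
  dot (a *: u) w = a * dot u w.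
Proof. by rewrite mulr_sumr; apply: eq_bigr => i _; rewrite mxE mulrA. Qed.

Lemma dotBl {R : realType} {n : nat} (u v w : 'cV[R]_n) :
  dot (u - v) w = dot u w - dot v w.
Proof. by rewrite dotDl -scaleN1r dotZl mulN1r. Qed.

Lemma dot0l {R : realType} {n : nat} (w : 'cV[R]_n) : dot 0 w = 0.
Proof. by rewrite -(scale0r 0) dotZl mul0r. Qed.

Lemma dot_suml {R : realType} {n : nat} {T : Type} (s : seq T) (P : pred T)
    (F : T -> 'cV[R]_n) (w : 'cV[R]_n) :
  dot (\sum_(i <- s | P i) F i) w = \sum_(i <- s | P i) dot (F i) w.
Proof.
by apply: (big_morph (fun u => dot u w)) => [u v|]; rewrite (dotDl, dot0l).
Qed.

Lemma dot_ge0 {R : realType} {n : nat} (u : 'cV[R]_n) : 0 <= dot u u.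
Proof. by apply: sumr_ge0 => i _; rewrite -expr2 sqr_ge0. Qed.

Lemma dot_eq0 {R : realType} {n : nat} (u : 'cV[R]_n) :
  (dot u u == 0) = (u == 0).
Proof.
apply/eqP/eqP => [u0|->]; last exact: dot0l.
apply/colP => i; rewrite mxE; apply/eqP; rewrite -sqrf_eq0 expr2; apply/eqP.
by apply: (psumr_eq0P _ u0) => // j _; rewrite -expr2 sqr_ge0.
Qed.

Lemma sqr_enorm {R : realType} {n : nat} (u : 'cV[R]_n) :
  enorm u ^+ 2 = dot u u.
Proof. by rewrite sqr_sqrtr ?dot_ge0. Qed.

Lemma enorm_gt0 {R : realType} {n : nat} (u : 'cV[R]_n) :
  (0 < enorm u) = (u != 0).
Proof. by rewrite sqrtr_gt0 lt_def dot_eq0 dot_ge0 andbT. Qed.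

Lemma enormZ {R : realType} {n : nat} (a : R) (u : 'cV[R]_n) :
  0 <= a -> enorm (a *: u) = a * enorm u.
Proof.
move=> a0; rewrite /enorm dotZl dotC dotZl mulrA -expr2 sqrtrM ?sqr_ge0//.
by rewrite sqrtr_sqr ger0_norm.
Qed.

Lemma big_mkseq {V : nmodType} {T : Type} (f : nat -> T) (k : nat)
    (F : T -> V) : \sum_(w <- mkseq f k) F w = \sum_(i < k) F (f i).
Proof. by rewrite big_map -{1}[k]subn0 -/(index_iota 0 k) big_mkord. Qed.

(** For an orthonormal family, the component of [x] orthogonal to the first [j] Gram-Schmidt
    vectors. Keeping [x] separate from [v j] makes it a linear map, which the comparison of two
    triangularly related families relies on. *)
Definition gs_residual {R : realType} {n : nat} (v : nat -> 'cV[R]_n)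
    (j : nat) (x : 'cV[R]_n) : 'cV[R]_n :=
  x - \sum_(k < j) dot x (gram_schmidt v k) *: gram_schmidt v k.

(** Each list extends the previous one by one vector, so the j-th vector is the same at whatever
    length it is read. *)
Lemma gram_schmidt_seqE {R : realType} {n : nat} (v : nat -> 'cV[R]_n)
    (k : nat) : gram_schmidt_seq v k = mkseq (gram_schmidt v) k.
Proof.
elim: k => // k IH; rewrite mkseqS -IH /gram_schmidt/= nth_rcons.
by rewrite IH size_mkseq ltnn eqxx.
Qed.

Lemma gram_schmidtE {R : realType} {n : nat} (v : nat -> 'cV[R]_n) (j : nat) :
  let u := gs_residual v j (v j) in gram_schmidt v j = (enorm u)^-1 *: u.
Proof.
rewrite {1}/gram_schmidt/= nth_rcons gram_schmidt_seqE size_mkseq ltnn eqxx.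
by rewrite big_mkseq.
Qed.

Lemma gram_schmidt_span {R : realType} {n : nat} (v : nat -> 'cV[R]_n)
    (i j : nat) : (j < i)%N -> gram_schmidt v j \in <<mkseq v i>>%VS.
Proof.
elim/ltn_ind: j => j IH ji; rewrite gram_schmidtE memvZ// memvB//.
  by apply: memv_span; apply/mapP; exists j; rewrite ?mem_iota.
by apply: memv_suml => k _; rewrite memvZ// IH// (ltn_trans _ ji).
Qed.

Lemma free_mkseq_notin {R : realType} {n m j : nat} {v : nat -> 'cV[R]_n} :
  free (mkseq v m) -> (j < m)%N -> v j \notin <<mkseq v j>>%VS.
Proof.
elim: m => // m IH; rewrite mkseqS (perm_free (permEl (perm_rcons _ _))).
by rewrite free_cons ltnS => /andP[vm fm]; case: ltngtP => // [/IH->|->].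
Qed.

(** A zero residual would put [v j] in the span of the earlier Gram-Schmidt vectors, hence of the
    earlier [v k], against freeness. *)
Lemma gs_residual_neq0 {R : realType} {n m j : nat} {v : nat -> 'cV[R]_n} :
  free (mkseq v m) -> (j < m)%N -> gs_residual v j (v j) != 0.
Proof.
move=> fv jm; apply: (contraNneq _ (free_mkseq_notin fv jm)) => /eqP.
rewrite subr_eq0 => /eqP ->; apply: memv_suml => k _.
by rewrite memvZ// gram_schmidt_span.
Qed.

Lemma gs_enorm_neq0 {R : realType} {n m j : nat} {v : nat -> 'cV[R]_n} :
  free (mkseq v m) -> (j < m)%N -> enorm (gs_residual v j (v j)) != 0.
Proof.
by move=> fv jm; rewrite gt_eqF// enorm_gt0 (gs_residual_neq0 fv).
Qed.

Lemma gs_orthonormal {R : realType} {n m : nat} {v : nat -> 'cV[R]_n}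
    {j k : nat} : free (mkseq v m) -> (j < m)%N -> (k < m)%N ->
  dot (gram_schmidt v j) (gram_schmidt v k) = (j == k)%:R.
Proof.
move=> fv; have normed i : (i < m)%N ->
    dot (gram_schmidt v i) (gram_schmidt v i) = 1.
  move=> im; rewrite gram_schmidtE dotZl dotC dotZl -sqr_enorm expr2.
  by rewrite mulKf ?mulVf// (gs_enorm_neq0 fv).
have orth i : (i < m)%N -> forall l, (l < i)%N ->
    dot (gram_schmidt v i) (gram_schmidt v l) = 0.
  elim/ltn_ind: i => i IH im l li; rewrite gram_schmidtE dotZl dotBl dot_suml.
  (* Of the subtracted projections only the one along index [l] pairs nontrivially with the l-th
     vector, and it cancels the pairing of [v i]; the others vanish by induction on the larger of
     the two indices. *)
  rewrite (bigD1 (Ordinal li))//= dotZl normed ?(ltn_trans li)// mulr1.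
  rewrite big1 ?addr0 ?subrr ?mulr0// => p /eqP pl; rewrite dotZl.
  have pm := ltn_trans (ltn_ord p) im.
  have [lp|pl'|lp] := ltngtP l p; first by rewrite IH ?mulr0.
    by rewrite [dot (gram_schmidt v p) _]dotC IH ?mulr0// (ltn_trans li).
  by case: pl; apply/val_inj.
move=> jm km; case: ltngtP => [jk|kj|->]; [|exact: orth|exact: normed].
by rewrite dotC orth.
Qed.

(** The projection part of [v j] is orthogonal to the j-th vector, which leaves the pairing of the
    residual with its own normalization. *)
Lemma gs_diag {R : realType} {n m j : nat} {v : nat -> 'cV[R]_n} :
  free (mkseq v m) -> (j < m)%N ->
  dot (v j) (gram_schmidt v j) = enorm (gs_residual v j (v j)).
Proof.
move=> fv jm; set u := gs_residual v j (v j).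
have u0 : enorm u != 0 := gs_enorm_neq0 fv jm.
have -> : v j
    = u + \sum_(k < j) dot (v j) (gram_schmidt v k) *: gram_schmidt v k.
  by rewrite subrK.
rewrite dotDl dot_suml big1 ?addr0 => [|k _]; last first.
  rewrite dotZl (gs_orthonormal fv)// ?(ltn_trans _ jm)//.
  by rewrite ltn_eqF ?mulr0.
by rewrite gram_schmidtE dotC dotZl -sqr_enorm expr2 mulKf.
Qed.

Lemma gs_diag_gt0 {R : realType} {n m j : nat} {v : nat -> 'cV[R]_n} :
  free (mkseq v m) -> (j < m)%N -> 0 < dot (v j) (gram_schmidt v j).
Proof.
by move=> fv jm; rewrite (gs_diag fv)// enorm_gt0 (gs_residual_neq0 fv).
Qed.

Lemma gs_expand_diag {R : realType} {n m j : nat} {v : nat -> 'cV[R]_n} :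
  free (mkseq v m) -> (j < m)%N ->
  v j = \sum_(k < j.+1) dot (v j) (gram_schmidt v k) *: gram_schmidt v k.
Proof.
move=> fv jm; rewrite big_ord_recr/= (gs_diag fv)// gram_schmidtE.
rewrite scalerA mulfV ?scale1r; first by rewrite addrC subrK.
exact: gs_enorm_neq0 fv jm.
Qed.

Lemma gs_lt0 {R : realType} {n m j k : nat} {v : nat -> 'cV[R]_n} :
  free (mkseq v m) -> (j < k)%N -> (k < m)%N ->
  dot (v j) (gram_schmidt v k) = 0.
Proof.
move=> fv jk km; rewrite (gs_expand_diag fv) ?(ltn_trans jk)// dot_suml.
rewrite big1// => l _; have lk : (l < k)%N by rewrite (leq_trans (ltn_ord l)).
by rewrite dotZl (gs_orthonormal fv)// ?(ltn_trans lk)// ltn_eqF ?mulr0.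
Qed.

(** The coefficients beyond index [j] vanish. The common range [i] lets all the expansions be read
    as one matrix product. *)
Lemma gs_expand {R : realType} {n m i j : nat} {v : nat -> 'cV[R]_n} :
  free (mkseq v m) -> (j < i)%N -> (i <= m)%N ->
  v j = \sum_(k < i) dot (v j) (gram_schmidt v k) *: gram_schmidt v k.
Proof.
move=> fv ji im; rewrite {1}(gs_expand_diag fv) ?(leq_trans ji)//.
pose F k := dot (v j) (gram_schmidt v k) *: gram_schmidt v k.
rewrite (big_ord_widen _ F ji) big_mkcond.
apply: eq_bigr => k _; case: ltnP => // jk.
by rewrite (gs_lt0 fv) ?scale0r// (leq_trans (ltn_ord k)).
Qed.

(** By orthonormality the Gram matrix is L L^T, where L is the lower triangular matrix of
    Gram-Schmidt coefficients. *)
Lemma det_gram {R : realType} {n m i : nat} {v : nat -> 'cV[R]_n} :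
  free (mkseq v m) -> (i <= m)%N ->
  \det (\matrix_(j < i, k < i) dot (v j) (v k))
  = (\prod_(j < i) dot (v j) (gram_schmidt v j)) ^+ 2.
Proof.
move=> fv im.
pose L := \matrix_(j < i, l < i) dot (v j) (gram_schmidt v l).
have -> : \matrix_(j < i, k < i) dot (v j) (v k) = L *m L^T.
  apply/matrixP => j k; rewrite !mxE {1}(gs_expand fv (ltn_ord j))// dot_suml.
  by apply: eq_bigr => l _; rewrite !mxE dotZl [dot _ (v k)]dotC.
rewrite det_mulmx det_tr det_trig.
  by rewrite -expr2; congr (_ ^+ 2); apply: eq_bigr => j _; rewrite mxE.
apply/is_trig_mxP => j l jl; rewrite mxE (gs_lt0 fv)//.
exact: leq_trans im.
Qed.

Lemma gs_residualD {R : realType} {n : nat} (v : nat -> 'cV[R]_n) (j : nat) :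
  {morph gs_residual v j : x y / x + y}.
Proof.
move=> x y; rewrite /gs_residual addrACA -opprD -big_split; congr (_ - _).
by apply: eq_bigr => k _; rewrite dotDl scalerDl.
Qed.

Lemma gs_residualZ {R : realType} {n : nat} (v : nat -> 'cV[R]_n) (j : nat)
    (a : R) (x : 'cV[R]_n) :
  gs_residual v j (a *: x) = a *: gs_residual v j x.
Proof.
rewrite /gs_residual scalerBr scaler_sumr; congr (_ - _).
by apply: eq_bigr => k _; rewrite dotZl scalerA.
Qed.

Lemma gs_residual0 {R : realType} {n : nat} (v : nat -> 'cV[R]_n) (j : nat) :
  gs_residual v j 0 = 0.
Proof. by rewrite -[0 in LHS](scale0r 0) gs_residualZ scale0r. Qed.

Lemma gs_residual_lt {R : realType} {n m k j : nat} {v : nat -> 'cV[R]_n} :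
  free (mkseq v m) -> (k < j)%N -> (j <= m)%N -> gs_residual v j (v k) = 0.
Proof. by move=> fv kj jm; rewrite /gs_residual -(gs_expand fv) ?subrr. Qed.

(* The residual of index j kills v_k for k < j, hence maps w_j to c_jj times
   the residual of v_j, and the normalization cancels c_jj > 0. *)
Lemma gram_schmidt_triangular {R : realType} {n m : nat}
    {v w : nat -> 'cV[R]_n} (c : nat -> nat -> R) :
  free (mkseq v m) ->
  (forall j, (j < m)%N -> w j = \sum_(k < j.+1) c j k *: v k) ->
  (forall j, (j < m)%N -> 0 < c j j) ->
  forall j, (j < m)%N -> gram_schmidt w j = gram_schmidt v j.
Proof.
move=> fv wE c0; elim/ltn_ind => j IH jm; rewrite !gram_schmidtE.
have resE x : gs_residual w j x = gs_residual v j x.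
  by congr (_ - _); apply: eq_bigr => k _; rewrite IH// (ltn_trans _ jm).
have resw : gs_residual w j (w j) = c j j *: gs_residual v j (v j).
  rewrite resE wE// (big_morph _ (gs_residualD v j) (gs_residual0 v j)).
  rewrite big_ord_recr/= big1 => [|k _]; first by rewrite add0r gs_residualZ.
  by rewrite gs_residualZ (gs_residual_lt fv) ?scaler0 ?(ltnW jm).
rewrite resw enormZ ?ltW ?c0// scalerA invfM mulrAC mulVf ?mul1r//.
by rewrite gt_eqF ?c0.
Qed.

(** * The generalized cross product as a determinant *)

Lemma dot_cross {R : realType} {n : nat} (B : 'M[R]_n.+1) :
  dot (cross (col' ord_max B)) (col ord_max B) = \det B.
Proof.
rewrite (expand_det_col B ord_max) /dot; apply: eq_bigr => i _.
by rewrite /cross /cofactor !mxE mulrC.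
Qed.

Definition rcons_mx {R : realType} {n : nat} (e : nat -> 'cV[R]_n.+1)
    (w : 'cV[R]_n.+1) : 'M[R]_n.+1 :=
  \matrix_(r, c) (if (c < n)%N then e c else w) r 0.

Lemma dot_cross_rcons {R : realType} {n : nat} (e : nat -> 'cV[R]_n.+1)
    (w : 'cV[R]_n.+1) :
  dot (cross (\matrix_(r, c) e c r 0)) w = \det (rcons_mx e w).
Proof.
rewrite -dot_cross; congr (dot (cross _) _).
  apply/matrixP => r c; rewrite !mxE lift_max.
  by have -> : (c < n)%N := ltn_ord c.
by apply/colP => r; rewrite !mxE ltnn.
Qed.

(** The determinant has a repeated column; transposing turns it into a repeated row, the form
    [determinant_alternate] takes. *)
Lemma dot_cross_eq0 {R : realType} {n k : nat} (e : nat -> 'cV[R]_n.+1) :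
  (k < n)%N -> dot (cross (\matrix_(r, c) e c r 0)) (e k) = 0.
Proof.
move=> kn; rewrite dot_cross_rcons -det_tr.
apply: (@determinant_alternate _ _ _ (inord k) ord_max).
  by rewrite -val_eqE/= inordK ?leqW// ltn_eqF.
by move=> r; rewrite !mxE/= ltnn inordK ?leqW// kn.
Qed.

(** Only the first n of the n + 1 columns are orthonormalized: [v_0 ... v_n] = [e_0 ... e_(n-1) v_n]
    U. The first factor has the cross product pairing as determinant; [U] is upper triangular with
    the coefficients r_j on the diagonal and a unit vector as last column. *)
Lemma det_gram_schmidt_cross {R : realType} {n : nat}
    {v : nat -> 'cV[R]_n.+1} : free (mkseq v n) ->
  \det (\matrix_(r < n.+1, c < n.+1) v c r 0)
  = dot (v n) (cross (\matrix_(r, c) gram_schmidt v c r 0))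
    * \prod_(j < n) dot (v j) (gram_schmidt v j).
Proof.
move=> fv; rewrite dotC dot_cross_rcons.
pose U : 'M[R]_n.+1 := \matrix_(l, c)
  if (c < n)%N then (if (l < n)%N then dot (v c) (gram_schmidt v l) else 0)
  else (l == c)%:R.
have -> : \matrix_(r < n.+1, c < n.+1) v c r 0
    = rcons_mx (gram_schmidt v) (v n) *m U.
  apply/matrixP => r c; rewrite !mxE big_ord_recr/= !mxE/= ltnn.
  case: ltnP => cn.
    rewrite mulr0 addr0 {1}(gs_expand fv cn)// summxE.
    by apply: eq_bigr => k _; rewrite !mxE/= !ltn_ord cn mulrC.
  have -> : c = ord_max.
    by apply/val_inj/eqP; rewrite eqn_leq cn -ltnS ltn_ord.
  rewrite eqxx mulr1 big1 ?add0r// => k _; rewrite !mxE/= ltnn.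
  by rewrite -val_eqE/= ltn_eqF ?mulr0.
rewrite det_mulmx; congr (_ * _); rewrite -det_tr det_trig.
  rewrite big_ord_recr/= !mxE/= ltnn eqxx mulr1; apply: eq_bigr => j _.
  by rewrite !mxE/= ltn_ord.
apply/is_trig_mxP => c l cl; rewrite !mxE.
have cn : (c < n)%N by rewrite (leq_trans cl)// -ltnS.
by rewrite cn; case: ltnP => // ln; rewrite (gs_lt0 fv).
Qed.

(** * Derivatives of vector-valued functions *)

Lemma is_derive_derive1 {R : realType} {V : normedModType R} {f : R -> V}
    {x : R} {df : V} : is_derive x 1 f df -> derive1 f x = df.
Proof. by move=> fd; rewrite derive1E derive_val. Qed.

Lemma derivable_is_derive1 {R : realType} {V : normedModType R} {f : R -> V}
    {x : R} : derivable f x 1 -> is_derive x 1 f (derive1 f x).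
Proof. by move=> fd; rewrite derive1E; exact: derivableP. Qed.

(** Reduces the product and chain rules for vector-valued functions to the scalar ones. *)
Lemma is_derive_colP {R : realType} {n : nat} (F : R -> 'cV[R]_n) (x : R)
    (D : 'cV[R]_n) :
  is_derive x 1 F D <-> forall i, is_derive x 1 (fun y => F y i 0) (D i 0).
Proof.
split=> [Fd i|Fd].
  have Fdx : derivable F x 1 by exact: ex_derive.
  have [+ _] := @derivable_mxP R R n 1 F x 1; move=> /(_ Fdx i 0) Fi.
  apply: DeriveDef => //.
  by rewrite -[D]derive_val derive_mx// mxE.
have Fdx : derivable F x 1.
  apply/(@derivable_mxP R R n 1 F x 1) => i j; rewrite ord1.
  exact: ex_derive.
apply: DeriveDef => //; rewrite derive_mx//; apply/colP => i.
by rewrite mxE derive_val.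
Qed.

Lemma is_derive_sumf {R : realType} {V : normedModType R} {n : nat}
    (f : 'I_n -> R -> V) (x : R) (df : 'I_n -> V) :
  (forall i, is_derive x 1 (f i) (df i)) ->
  is_derive x 1 (fun y => \sum_(i < n) f i y) (\sum_(i < n) df i).
Proof.
move=> fd; rewrite (_ : (fun y => _) = \sum_(i < n) f i).
  exact: is_derive_sum.
by apply/funext => y; rewrite fct_sumE.
Qed.

Lemma is_derive_mulf {R : realType} (f g : R -> R) (x df dg : R) :
  is_derive x 1 f df -> is_derive x 1 g dg ->
  is_derive x 1 (fun y => f y * g y) (f x * dg + df * g x).
Proof.
move=> fd gd; apply: is_derive_eq (is_deriveM fd gd) _.
by rewrite [df * _]mulrC.
Qed.

Lemma is_derive_scale {R : realType} {n : nat} (c : R -> R)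
    (F : R -> 'cV[R]_n) (x dc : R) (D : 'cV[R]_n) :
  is_derive x 1 c dc -> is_derive x 1 F D ->
  is_derive x 1 (fun y => c y *: F y) (c x *: D + dc *: F x).
Proof.
move=> cd /is_derive_colP Fd; apply/is_derive_colP => i; rewrite !mxE.
rewrite (_ : (fun y => _) = fun y => c y * F y i 0).
  exact: is_derive_mulf.
by apply/funext => y; rewrite mxE.
Qed.

Lemma is_derive_dot {R : realType} {n : nat} (F G : R -> 'cV[R]_n) (x : R)
    (D E : 'cV[R]_n) : is_derive x 1 F D -> is_derive x 1 G E ->
  is_derive x 1 (fun y => dot (F y) (G y)) (dot (F x) E + dot D (G x)).
Proof.
move=> /is_derive_colP Fd /is_derive_colP Gd; rewrite -big_split.
by apply: is_derive_sumf => i; exact: is_derive_mulf.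
Qed.

Lemma is_derive_comp_col {R : realType} {n : nat} (F : R -> 'cV[R]_n)
    (phi : R -> R) (x a : R) (D : 'cV[R]_n) :
  is_derive x 1 phi a -> is_derive (phi x) 1 F D ->
  is_derive x 1 (F \o phi) (a *: D).
Proof.
move=> phid /is_derive_colP Fd; apply/is_derive_colP => i; rewrite mxE mulrC.
exact: is_derive1_comp.
Qed.

Lemma is_derive_enorm {R : realType} {n : nat} (F : R -> 'cV[R]_n) (x : R)
    (D : 'cV[R]_n) : F x != 0 -> is_derive x 1 F D ->
  is_derive x 1 (fun y => enorm (F y)) (dot (F x) D / enorm (F x)).
Proof.
move=> F0 Fd; have s0 : 0 < dot (F x) (F x).
  by rewrite lt_def dot_eq0 F0 dot_ge0.
have d2 := is_derive_dot _ _ _ _ _ Fd Fd.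
apply: is_derive_eq (is_derive1_comp (is_derive1_sqrt s0) d2) _.
rewrite [dot D _]dotC -mulr2n -[dot _ _ *+ 2]mulr_natl invfM.
rewrite mulrACA mulVf ?pnatr_eq0// mul1r.
by rewrite mulrC.
Qed.

(** * Smooth real functions on an open set *)

Fixpoint diff_on {R : realType} (I : set R) (k : nat) (f : R -> R) : Prop :=
  if k is k'.+1 then
    (forall x, I x -> derivable f x 1) /\ diff_on I k' (derive1 f)
  else True.

Definition smooth_on {R : realType} (I : set R) (f : R -> R) : Prop :=
  forall k, diff_on I k f.

Lemma diff_onW {R : realType} {I : set R} (k : nat) (f : R -> R) :
  diff_on I k.+1 f -> diff_on I k f.
Proof.
elim: k f => // k IH f [fd fd']; split=> //; exact: IH.
Qed.

Lemma open_near_eq {R : realType} {V : Type} {I : set R} {f g : R -> V}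
    {x : R} : open I -> {in I, f =1 g} -> I x -> \near x, f x = g x.
Proof.
move=> oI fg Ix; have := open_nbhs_nbhs (conj oI Ix).
by apply: filterS => y Iy; apply: fg; rewrite inE.
Qed.

Lemma eq_on_derive1 {R : realType} {V : normedModType R} {I : set R}
    {f g : R -> V} :
  open I -> {in I, f =1 g} -> {in I, derive1 f =1 derive1 g}.
Proof.
move=> oI fg x /set_mem Ix; rewrite !derive1E; apply: near_eq_derive.
exact: open_near_eq oI fg Ix.
Qed.

Lemma eq_diff_on {R : realType} {I : set R} (k : nat) (f g : R -> R) :
  open I -> {in I, f =1 g} -> diff_on I k f -> diff_on I k g.
Proof.
move=> oI; elim: k f g => // k IH f g fg [fd fd']; split.
  move=> x Ix; apply: near_eq_derivable (fd x Ix).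
  exact: open_near_eq oI fg Ix.
by apply: IH fd'; exact: eq_on_derive1.
Qed.

(** Allows the derivative to be given by a formula [df] valid on [I] only, since differentiation on
    an open set is local. *)
Lemma diff_onS {R : realType} {I : set R} (k : nat) (f df : R -> R) :
  open I -> (forall x, I x -> is_derive x 1 f (df x)) ->
  diff_on I k df -> diff_on I k.+1 f.
Proof.
move=> oI fd dfk; split=> [x /fd ?|]; first exact: ex_derive.
apply: eq_diff_on oI _ dfk => x /set_mem Ix.
by have ? := fd x Ix; rewrite (is_derive_derive1 (fd x Ix)).
Qed.

Lemma diff_on_is_derive {R : realType} {I : set R} {k : nat} {f : R -> R}
    {x : R} : diff_on I k.+1 f -> I x -> is_derive x 1 f (derive1 f x).
Proof. by move=> [fd _] /fd; exact: derivable_is_derive1. Qed.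

Lemma diff_on_add {R : realType} {I : set R} (k : nat) (f g : R -> R) :
  open I -> diff_on I k f -> diff_on I k g ->
  diff_on I k (fun x => f x + g x).
Proof.
move=> oI; elim: k f g => // k IH f g fk gk.
apply: (@diff_onS _ _ _ _ (fun x => derive1 f x + derive1 g x) oI).
  move=> x Ix.
  exact: is_deriveD (diff_on_is_derive fk Ix) (diff_on_is_derive gk Ix).
by apply: IH; [exact: fk.2|exact: gk.2].
Qed.

Lemma diff_on_mul {R : realType} {I : set R} (k : nat) (f g : R -> R) :
  open I -> diff_on I k f -> diff_on I k g ->
  diff_on I k (fun x => f x * g x).
Proof.
move=> oI; elim: k f g => // k IH f g fk gk.
apply: (@diff_onS _ _ _ _ (fun x => f x * derive1 g x + derive1 f x * g x) oI).
  move=> x Ix.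
  exact: is_derive_mulf (diff_on_is_derive fk Ix) (diff_on_is_derive gk Ix).
apply: diff_on_add => //; apply: IH.
- exact: diff_onW.
- exact: gk.2.
- exact: fk.2.
- exact: diff_onW.
Qed.

Lemma derive1_cstE {R : realType} (a : R) :
  derive1 (fun=> a : R) = (fun=> 0) :> (R -> R).
Proof. by apply/funext => x; rewrite derive1_cst. Qed.

Lemma diff_on_cst {R : realType} (I : set R) (k : nat) (a : R) :
  diff_on I k (fun=> a).
Proof.
elim: k a => // k IH a; split=> [x _|]; first exact: derivable_cst.
by rewrite derive1_cstE; exact: IH.
Qed.

Lemma diff_on_sum {R : realType} {I : set R} (k n : nat)
    (f : 'I_n -> R -> R) : open I -> (forall i, diff_on I k (f i)) ->
  diff_on I k (fun x => \sum_(i < n) f i x).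
Proof.
move=> oI; elim: n f => [|n IH] f fk.
  by under eq_fun do rewrite big_ord0; exact: diff_on_cst.
under eq_fun do rewrite big_ord_recr/=.
by apply: diff_on_add => //; exact: IH.
Qed.

Lemma smooth_on_derive1 {R : realType} {I : set R} (f : R -> R) :
  smooth_on I f -> smooth_on I (derive1 f).
Proof. by move=> fs k; have [] := fs k.+1. Qed.

Lemma smooth_on_is_derive {R : realType} {I : set R} {f : R -> R}
    {x : R} : smooth_on I f -> I x -> is_derive x 1 f (derive1 f x).
Proof. by move=> fs; exact: diff_on_is_derive (fs 1%N). Qed.

Lemma smooth_on_coord {R : realType} {n : nat} {I : set R}
    (g : R -> 'cV[R]_n) (j : nat) (i : 'I_n) : open I ->
  (forall k t, I t -> derivable (derive1n k g) t 1) ->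
  smooth_on I (fun x => derive1n j g x i 0).
Proof.
move=> oI gs k; elim: k j => // k IH j.
apply: diff_onS (oI) _ (IH j.+1) => x Ix.
by have /is_derive_colP := derivable_is_derive1 (gs j x Ix).
Qed.

(* 1 / ||g'|| solves p' = h p^3 with h smooth, so its regularity bootstraps. *)
Lemma smooth_on_cubic_ode {R : realType} {I : set R} (h p : R -> R) :
  open I -> smooth_on I h ->
  (forall x, I x -> is_derive x 1 p (h x * (p x * (p x * p x)))) ->
  smooth_on I p.
Proof.
move=> oI hs pd; elim=> // k IH; apply: diff_onS (oI) pd _.
by apply: diff_on_mul (oI) (hs k) _; do 2!apply: diff_on_mul => //.
Qed.

Lemma smooth_on_inv_speed {R : realType} {n : nat} {I : set R}
    (g : R -> 'cV[R]_n) : parametrized_curve I g ->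
  smooth_on I (fun x => (enorm (derive1 g x))^-1).
Proof.
move=> [oI _ gs g0].
(* Here h comes from (1 / ||g'||)' = - <g', g''> / ||g'||^3. *)
apply: (@smooth_on_cubic_ode _ _
  (fun x => - 1 * dot (derive1n 1 g x) (derive1n 2 g x))) => //.
  move=> k; apply: diff_on_mul (oI) _ _; first exact: diff_on_cst.
  apply: diff_on_sum => // i.
  by apply: diff_on_mul => //; exact: smooth_on_coord.
move=> x Ix; have v0 : enorm (derive1 g x) != 0.
  by rewrite gt_eqF ?enorm_gt0 ?g0.
have vd := is_derive_enorm _ _ _ (g0 x Ix) (derivable_is_derive1 (gs 1%N x Ix)).
pose speed y := enorm (derive1 g y).
have pd := is_deriveV (v0 : speed x != 0) vd.
apply: is_derive_eq pd _.
rewrite /= mulN1r mulNr scaleNr; congr (- _).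
by rewrite /GRing.scale/= mulrCA -exprVn expr2 -mulrA.
Qed.

(* With p = 1 / ||g'||, the derivative with respect to arclength is p times the
   derivative; [reparam_coef p k j] is the coefficient of [derive1n j.+1 g] in
   the arclength derivative of order k.+1. *)
Fixpoint reparam_coef {R : realType} (p : R -> R) (k j : nat) : R -> R :=
  match k, j with
  | 0, 0 => p
  | 0, _ => fun=> 0
  | k'.+1, 0 => fun x => p x * derive1 (reparam_coef p k' 0) x
  | k'.+1, j'.+1 => fun x =>
      p x * (derive1 (reparam_coef p k' j) x + reparam_coef p k' j' x)
  end.

Lemma reparam_coef_gt {R : realType} (p : R -> R) (k j : nat) :
  (k < j)%N -> reparam_coef p k j = fun=> 0.
Proof.
elim: k j => [|k IH] [|j]//= kj; rewrite !IH ?(ltnW kj)// derive1_cstE.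
by apply/funext => x; rewrite addr0 mulr0.
Qed.

(** The top coefficient arises only by differentiating the top derivative of the curve, which brings
    one more factor [p] each time. *)
Lemma reparam_coef_diag {R : realType} (p : R -> R) (k : nat) (x : R) :
  reparam_coef p k k x = p x ^+ k.+1.
Proof.
elim: k => [|k IH] /=; first by rewrite expr1.
by rewrite reparam_coef_gt// derive1_cstE add0r IH -exprS.
Qed.

Lemma smooth_on_reparam_coef {R : realType} {I : set R} (p : R -> R)
    (k j : nat) : open I -> smooth_on I p -> smooth_on I (reparam_coef p k j).
Proof.
move=> oI ps; elim: k j => [|k IH] [|j] //= m.
- exact: diff_on_cst.
- by apply: diff_on_mul => //; exact: smooth_on_derive1.
apply: diff_on_mul => //; apply: diff_on_add => //; last exact: IH.
by apply: smooth_on_derive1; exact: IH.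
Qed.

(** Since phi' = p o phi, differentiating F o phi amounts to applying p d/dx to F. The product rule
    on each summand then reproduces the recursion of [reparam_coef]. *)
Lemma derive1n_reparam {R : realType} {n : nat} {I J : set R}
    (g : R -> 'cV[R]_n) (p phi : R -> R) :
  open I -> open J ->
  (forall k t, I t -> derivable (derive1n k g) t 1) -> smooth_on I p ->
  (forall y, J y -> I (phi y)) ->
  (forall y, J y -> is_derive y 1 phi (p (phi y))) ->
  forall k y, J y -> derive1n k.+1 (g \o phi) y
    = \sum_(j < k.+1) reparam_coef p k j (phi y) *: derive1n j.+1 g (phi y).
Proof.
move=> oI oJ gs ps phiI phid.
have comp_derive (F : R -> 'cV[R]_n) y D : J y -> is_derive (phi y) 1 F D ->
    derive1 (F \o phi) y = p (phi y) *: D.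
  move=> Jy Fd; apply: is_derive_derive1.
  exact: is_derive_comp_col (phid y Jy) Fd.
elim=> [|k IH] y Jy.
  have gd := derivable_is_derive1 (gs 0%N _ (phiI y Jy)).
  by rewrite big_ord1/= (comp_derive _ _ _ Jy gd).
pose F x := \sum_(j < k.+1) reparam_coef p k j x *: derive1n j.+1 g x.
(* The induction hypothesis holds on all of the open set [J], so both sides may be
   differentiated. *)
rewrite derive1nS (@eq_on_derive1 _ _ J _ (F \o phi)) ?inE//; last first.
  by move=> z /set_mem Jz; exact: IH.
pose D x := \sum_(j < k.+1) (reparam_coef p k j x *: derive1n j.+2 g x
    + derive1 (reparam_coef p k j) x *: derive1n j.+1 g x).
have Fd : is_derive (phi y) 1 F (D (phi y)).
  apply: is_derive_sumf => j; apply: is_derive_scale.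
    exact: smooth_on_is_derive (smooth_on_reparam_coef _ _ _ oI ps) (phiI y Jy).
  exact: derivable_is_derive1 (gs j.+1 _ (phiI y Jy)).
rewrite (comp_derive _ _ _ Jy Fd) /D big_split/= addrC scalerDr.
rewrite big_ord_recl/= scalerDr -addrA.
rewrite [RHS]big_ord_recl/= scalerA; congr (_ + _).
under [RHS]eq_bigr do rewrite mulrDr scalerDl.
rewrite big_split/= !scaler_sumr; congr (_ + _); last first.
  by apply: eq_bigr => j _; rewrite scalerA.
(* The one extra summand on the right involves the derivative of a coefficient above the diagonal,
   which is zero. *)
rewrite [RHS]big_ord_recr/= reparam_coef_gt// derive1_cstE mulr0 scale0r addr0.
by apply: eq_bigr => j _; rewrite scalerA.
Qed.

(** * Arclength *)

Lemma derivable_continuous {R : realType} {f : R -> R} {x df : R} :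
  is_derive x 1 f df -> {for x, continuous f}.
Proof. by move=> fd; exact/differentiable_continuous/derivable1_diffP. Qed.

Lemma open_itv_nbhs {R : realType} {I : set R} {x : R} :
  open I -> I x -> exists e, [/\ 0 < e, I (x - e) & I (x + e)].
Proof.
move=> oI Ix; have /nbhs_ballP[e /= e0 eI] := open_nbhs_nbhs (conj oI Ix).
have he : `|e / 2| < e.
  by rewrite gtr0_norm ?divr_gt0// ltr_pdivrMr// ltr_pMr// ltr1n.
exists (e / 2); split; first by rewrite divr_gt0.
  by apply: eI; rewrite /ball/= opprB addrC subrK.
by apply: eI; rewrite /ball/= opprD addrA subrr sub0r normrN.
Qed.

Lemma Rintegral_segmentB {R : realType} {f : R -> R} {a b y z : R} :
  lebesgue_measure.-integrable `[a, b] (EFin \o f) ->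
  a <= y -> y <= z -> z <= b ->
  \int[lebesgue_measure]_(x in `[a, z]) f x
    - \int[lebesgue_measure]_(x in `[a, y]) f x
  = \int[lebesgue_measure]_(x in `[y, z]) f x.
Proof.
move=> fi ay yz zb.
have fz : lebesgue_measure.-integrable `[a, z] (EFin \o f).
  by apply: integrableS fi => //; apply: subset_itv; rewrite bnd_simp.
rewrite Rintegral_itvB ?bnd_simp// Rintegral_itv_obnd_cbnd//.
by apply: integrableS fz => //; apply: subset_itv; rewrite bnd_simp.
Qed.

(** With a base point [a] of [I] to the left of both [t0] and [t], the oriented integral is F x - F
    t0 near [t] for F the integral from [a]. This covers both signs, and the fundamental theorem
    applies to F. *)
Lemma is_derive_oriented_integral {R : realType} {I : set R} (f : R -> R)
    (t0 t : R) : open I -> is_interval I ->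
  (forall x, I x -> {for x, continuous f}) -> I t0 -> I t ->
  is_derive t 1 (fun x =>
    if t0 <= x then \int[lebesgue_measure]_(y in `[t0, x]) f y
    else - \int[lebesgue_measure]_(y in `[x, t0]) f y) (f t).
Proof.
move=> oI itI fc It0 It.
have [a [Ia at0 at1]] : exists a, [/\ I a, a < t0 & a < t].
  have Im : I (Num.min t0 t) by case: leP.
  have [e [e0 Ie _]] := open_itv_nbhs oI Im; exists (Num.min t0 t - e).
  by split=> //; rewrite ltrBlDr gt_min ltrDl e0 ?orbT.
have [b [Ib bt0 bt1]] : exists b, [/\ I b, t0 < b & t < b].
  have Im : I (Num.max t0 t) by case: leP.
  have [e [e0 _ Ie]] := open_itv_nbhs oI Im; exists (Num.max t0 t + e).
  by split=> //; rewrite -ltrBlDr lt_max !ltrBlDr ltrDl e0 ?orbT.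
have fi : lebesgue_measure.-integrable `[a, b] (EFin \o f).
  apply: continuous_compact_integrable; first exact: segment_compact.
  apply: continuous_in_subspaceT => x /set_mem/=; rewrite in_itv/= => axb.
  by apply: fc; exact: itI axb.
pose F x := \int[lebesgue_measure]_(y in `[a, x]) f y.
have [Fd Fdf] := continuous_FTC1_closed bt1 fi at1 (fc t It).
have Fd' : is_derive t 1 F (f t).
  by rewrite -Fdf; exact: derivable_is_derive1 Fd.
apply: (@near_eq_is_derive _ _ _ (fun x => F x - F t0)); last first.
  by rewrite -[f t]subr0; apply: is_deriveB Fd' (is_derive_cst _ _ _).
have : \forall x \near t, x \in `]a, b[.
  by apply: near_in_itvoo; rewrite in_itv/= at1.
apply: filterS => x; rewrite in_itv/= => /andP[ax xb].
case: leP => t0x.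
  exact: Rintegral_segmentB fi (ltW at0) t0x (ltW xb).
by rewrite -(Rintegral_segmentB fi (ltW ax) (ltW t0x) (ltW bt0)) opprB.
Qed.

Section arclength_inverse.
Context {R : realType} {n : nat} {I : set R} {g : R -> 'cV[R]_n} {t0 : R}.
Hypotheses (hg : parametrized_curve I g) (It0 : I t0).
Let s := arclength g t0.
Let phi := 'pinv_(fun=> t0) I s.
Let speed x := enorm (derive1 g x).

Lemma speed_gt0 x : I x -> 0 < speed x.
Proof. by case: hg => _ _ _ g0 Ix; rewrite enorm_gt0 g0. Qed.

Lemma is_derive_arclength x : I x -> is_derive x 1 s (speed x).
Proof.
case: hg => oI itI gs g0 Ix.
apply: (is_derive_oriented_integral speed t0 x oI itI _ It0 Ix) => y Iy.
exact: derivable_continuous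
  (is_derive_enorm _ _ _ (g0 y Iy) (derivable_is_derive1 (gs 1%N y Iy))).
Qed.

Lemma arclength_lt x y : I x -> I y -> x < y -> s x < s y.
Proof.
move=> Ix Iy xy; have [_ itI _ _] := hg.
have Iz z : z \in `[x, y] -> I z by rewrite in_itv/=; exact: itI Ix Iy z.
have Izo z : z \in `]x, y[ -> I z by move=> /subset_itv_oo_cc; exact: Iz.
apply: (@gtr0_derive1_incr _ s x y) => //.
- by move=> z /Izo /is_derive_arclength ?; exact: ex_derive.
- move=> z /Izo Isz.
  by rewrite (is_derive_derive1 (is_derive_arclength _ Isz)) speed_gt0.
- apply: derivable_within_continuous => z /Iz /is_derive_arclength ?.
  exact: ex_derive.
Qed.

Lemma arclengthK : {in I, cancel s phi}.
Proof.
apply: pinvKV => x y /set_mem Ix /set_mem Iy sxy; apply/eqP.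
by case: (ltgtP x y) => // /arclength_lt; rewrite sxy ltxx => ->.
Qed.

Lemma near_arclength_continuous x : I x -> \near x, {for x, continuous s}.
Proof.
move=> Ix; have [oI _ _ _] := hg; have := open_nbhs_nbhs (conj oI Ix).
by apply: filterS => y /is_derive_arclength; exact: derivable_continuous.
Qed.

Lemma near_arclengthK x : I x -> {near x, cancel s phi}.
Proof.
move=> Ix; have [oI _ _ _] := hg; have := open_nbhs_nbhs (conj oI Ix).
by apply: filterS => y Iy; rewrite arclengthK ?inE.
Qed.

Lemma is_derive_arclength_inv x : I x -> is_derive (s x) 1 phi (speed x)^-1.
Proof.
move=> Ix; apply: is_derive_inverse; first exact: near_arclengthK.
- exact: near_arclength_continuous.
- exact: is_derive_arclength.
- by rewrite gt_eqF ?speed_gt0.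
Qed.

(** The set is the image of [I] under [s], described through [phi] because the pseudo-inverse is
    meaningful only there. Near such a point [phi] is continuous, stays in [I], and is a two-sided
    inverse of [s]. *)
Lemma open_arclength_image : open [set y | I (phi y) /\ s (phi y) = y].
Proof.
have [oI _ _ _] := hg; rewrite openE => y [Iphi sphi].
have phic : {for y, continuous phi}.
  rewrite -sphi; exact: derivable_continuous (is_derive_arclength_inv _ Iphi).
have phiI : \forall z \near y, I (phi z).
  by apply: phic; exact: open_nbhs_nbhs.
have phiK : {near y, cancel phi s}.
  rewrite -sphi; apply: near_continuous_can_sym; last exact: near_arclengthK.
  exact: near_arclength_continuous.
by apply: filterS2 phiI phiK => z.
Qed.

End arclength_inverse.

(** * The Frenet frame and the curvatures *)

(** By induction the residual is differentiable; it is nonzero at [x] by freeness, so its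
    normalization is differentiable too. *)
Lemma gram_schmidt_derivable {R : realType} {n m : nat}
    (v : nat -> R -> 'cV[R]_n) (x : R) :
  free (mkseq (v ^~ x) m) -> (forall k, derivable (v k) x 1) ->
  forall j, (j < m)%N -> derivable (fun y => gram_schmidt (v ^~ y) j) x 1.
Proof.
move=> fv vd; elim/ltn_ind => j IH jm.
pose e k y := gram_schmidt (v ^~ y) k.
pose u y := gs_residual (v ^~ y) j (v j y).
pose norm_u y := enorm (u y).
have ed (k : 'I_j) : is_derive x 1 (e k) (derive1 (e k) x).
  by apply: derivable_is_derive1; apply: IH => //; rewrite (ltn_trans _ jm).
have vjd := derivable_is_derive1 (vd j).
have ud : is_derive x 1 u _ := is_deriveB vjd (is_derive_sumf _ _ _ (fun k =>
  is_derive_scale _ _ _ _ _ (is_derive_dot _ _ _ _ _ vjd (ed k)) (ed k))).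
have u0 : u x != 0 := gs_residual_neq0 fv jm.
have nd : is_derive x 1 norm_u _ := is_derive_enorm _ _ _ u0 ud.
have n0 : norm_u x != 0 by rewrite gt_eqF ?enorm_gt0.
have -> : (fun y => gram_schmidt (v ^~ y) j) = (fun y => (norm_u y)^-1 *: u y).
  by apply/funext => y; rewrite gram_schmidtE.
have ? := is_derive_scale _ _ _ _ _ (is_deriveV n0 nd) ud; exact: ex_derive.
Qed.

Lemma dot_gram_schmidt_eq0 {R : realType} {n : nat} (v : nat -> 'cV[R]_n)
    (w : 'cV[R]_n) (i : nat) : (forall k, (k <= i)%N -> dot (v k) w = 0) ->
  dot (gram_schmidt v i) w = 0.
Proof.
elim/ltn_ind: i => i IH vw; rewrite gram_schmidtE dotZl dotBl dot_suml.
rewrite vw// big1 ?subr0 ?mulr0// => k _; rewrite dotZl IH ?mulr0// => l lk.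
by rewrite vw// (leq_trans lk)// ltnW.
Qed.

(* Differentiate [<v_j, w> = sum_(k <= j) <v_j, e_k> <e_k, w>] at t, where all
   [<e_k, w>] vanish; by induction only the last term survives. *)
Lemma dot_derive1_gram_schmidt {R : realType} {n m : nat} {I : set R}
    (v : nat -> R -> 'cV[R]_n) (t : R) (w : 'cV[R]_n) (i : nat) :
  open I -> (forall x, I x -> free (mkseq (v ^~ x) m)) ->
  (forall k x, I x -> is_derive x 1 (v k) (v k.+1 x)) ->
  I t -> (i < m)%N -> (forall k, (k <= i)%N -> dot (v k t) w = 0) ->
  dot (v i t) (gram_schmidt (v ^~ t) i)
    * dot (derive1 (fun y => gram_schmidt (v ^~ y) i) t) w
  = dot (v i.+1 t) w.
Proof.
move=> oI fv vd It; elim/ltn_ind: i => i IH im vw.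
pose e k y := gram_schmidt (v ^~ y) k.
have ed (k : 'I_i.+1) : is_derive t 1 (e k) (derive1 (e k) t).
  apply: derivable_is_derive1; apply: gram_schmidt_derivable (fv t It) _ _ _.
    by move=> l; have := vd l t It => ?; exact: ex_derive.
  by rewrite (leq_trans (ltn_ord k)).
have ew0 (k : 'I_i.+1) : dot (e k t) w = 0.
  apply: dot_gram_schmidt_eq0 => l lk; apply: vw.
  by rewrite (leq_trans lk)// -ltnS.
have wd := is_derive_cst w t 1.
have lhs := is_derive_dot _ _ _ _ _ (vd i t It) wd.
have rhs := is_derive_sumf _ _ _ (fun k => is_derive_mulf _ _ _ _ _
  (is_derive_dot _ _ _ _ _ (vd i t It) (ed k))
  (is_derive_dot _ _ _ _ _ (ed k) wd)).
have lr : \near t, dot (v i t) w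
    = \sum_(k < i.+1) dot (v i t) (e k t) * dot (e k t) w.
  apply: open_near_eq oI _ It => x /set_mem Ix.
  rewrite {1}(gs_expand_diag (fv x Ix) im) dot_suml.
  by apply: eq_bigr => k _; rewrite dotZl.
have dotw0 (u : 'cV[R]_n) : dot u 0 = 0 by rewrite dotC dot0l.
have := is_derive_derive1 (near_eq_is_derive lr lhs).
rewrite (is_derive_derive1 rhs) dotw0 add0r => <-.
rewrite big_ord_recr big1/= => [|k _]; last first.
  rewrite dotw0 add0r (ew0 (widen_ord (leqnSn i) k)) mulr0 addr0.
  have ki : (k < m)%N := ltn_trans (ltn_ord k) im.
  apply/eqP; rewrite mulf_eq0; apply/orP; right.
  (* By induction this product is <v_(k+1), w>, zero because k + 1 <= i; as r_k > 0, the other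
     factor must vanish. *)
  have : dot (v k t) (e k t) * dot (derive1 (e k) t) w = 0.
    rewrite IH// ?vw// => l lk; rewrite vw// (leq_trans lk)//.
    exact: ltnW.
  by move/eqP; rewrite mulf_eq0 gt_eqF// (gs_diag_gt0 (fv t It)).
by rewrite add0r dotw0 add0r (ew0 ord_max) mulr0 addr0.
Qed.

(** * Invariance of the Frenet frame and the curvatures as quotients *)

Lemma frenetE {R : realType} {m : nat} (g : R -> 'cV[R]_m.+1) (j : nat) :
  (j < m)%N ->
  frenet g j = fun y => gram_schmidt (fun k => derive1n k.+1 g y) j.
Proof. by move=> jm; apply/funext => y; rewrite /frenet/= jm. Qed.

Lemma frenet_lastE {R : realType} {m : nat} (g : R -> 'cV[R]_m.+1) (y : R) :
  frenet g m y
  = cross (\matrix_(r, c) gram_schmidt (fun k => derive1n k.+1 g y) c r 0).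
Proof. by rewrite /frenet/= ltnn. Qed.

Section frenet_frame.
Context {R : realType} {m : nat} {I : set R} {g : R -> 'cV[R]_m.+1} {t0 : R}.
Hypotheses (hg : parametrized_curve I g) (hord : has_order I g m) (It0 : I t0).
Let s := arclength g t0.
Let phi := 'pinv_(fun=> t0) I s.
Let v k x := derive1n k.+1 g x.

(** For the last vector, [v k] is expanded in the Gram-Schmidt vectors, all orthogonal to their
    cross product. *)
Lemma dot_frenet_eq0 t i k : I t -> (k < i)%N -> (i <= m)%N ->
  dot (v k t) (frenet g i t) = 0.
Proof.
move=> It ki; have fv : free (mkseq (v ^~ t) m) := hord t It.
rewrite leq_eqVlt => /predU1P[im|im]; last by rewrite frenetE// (gs_lt0 fv).
rewrite im in ki *; rewrite frenet_lastE (gs_expand fv ki (leqnn m)) dot_suml.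
rewrite big1// => l _.
by rewrite dotZl [dot _ (cross _)]dotC dot_cross_eq0 ?mulr0.
Qed.

(** The derivatives of the reparametrized curve are triangular combinations of those of [g], with
    positive diagonal p^(k+1), and such a change leaves the Gram-Schmidt vectors fixed. *)
Lemma gram_schmidt_reparam j y : (j < m)%N -> I (phi y) -> s (phi y) = y ->
  gram_schmidt (fun k => derive1n k.+1 (g \o phi) y) j
  = gram_schmidt (v ^~ (phi y)) j.
Proof.
move=> jm Iphi sphi; have [oI _ gs _] := hg.
pose p x := (enorm (derive1 g x))^-1.
apply: (@gram_schmidt_triangular _ _ m _ _
  (fun k j => reparam_coef p k j (phi y))) => //.
- exact: hord.
- move=> k _; apply: (derive1n_reparam _ _ _ oI (open_arclength_image hg It0) gs
    (smooth_on_inv_speed _ hg)) => //.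
    by move=> z [].
  by move=> z [Iz {1}<-]; exact: is_derive_arclength_inv.
- move=> k _; rewrite reparam_coef_diag exprn_gt0// invr_gt0.
  exact: speed_gt0 hg _ Iphi.
Qed.

Lemma frenet_reparam j y : (j <= m)%N -> I (phi y) -> s (phi y) = y ->
  frenet (g \o phi) j y = frenet g j (phi y).
Proof.
rewrite leq_eqVlt => /predU1P[->|jm] Iphi sphi; last first.
  rewrite !(frenetE _ _ jm); exact: gram_schmidt_reparam jm Iphi sphi.
rewrite !frenet_lastE; apply: (f_equal (@cross R m.+1)).
apply/matrixP => r c; rewrite [LHS]mxE [RHS]mxE.
rewrite (gram_schmidt_reparam _ _ (ltn_ord c) Iphi sphi).
reflexivity.
Qed.

(** The chain rule through [phi] gives the factor 1 / ||g'||. The quotient is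
    [dot_derive1_gram_schmidt] with the next Frenet vector as [w], the cross product when i + 1 =
    m. *)
Lemma curvatureE i t : (i < m)%N -> I t ->
  curvature I g t0 i.+1 t
  = (enorm (derive1 g t))^-1
    * (dot (v i.+1 t) (frenet g i.+1 t)
       / dot (v i t) (gram_schmidt (v ^~ t) i)).
Proof.
move=> im It; have [oI _ gs _] := hg.
have phis : phi (s t) = t by apply: arclengthK; rewrite ?inE.
have oJ := open_arclength_image hg It0.
have Js : [set y | I (phi y) /\ s (phi y) = y] (s t) by rewrite /= phis.
have fv x : I x -> free (mkseq (v ^~ x) m) by exact: hord.
have ed : is_derive t 1 (frenet g i) (derive1 (frenet g i) t).
  apply: derivable_is_derive1; rewrite frenetE//.
  by apply: gram_schmidt_derivable (fv t It) _ _ im => k; exact: gs k.+1 t It.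
have phid := is_derive_arclength_inv hg It0 t It.
have -> : curvature I g t0 i.+1 t
    = dot (derive1 (frenet (g \o phi) i) (s t)) (frenet (g \o phi) i.+1 (s t)).
  reflexivity.
(* Equality of the frames at [s t] alone would not suffice to compare derivatives; it is needed on
   an open set. *)
have fr : {in [set y | I (phi y) /\ s (phi y) = y],
    frenet (g \o phi) i =1 frenet g i \o phi}.
  by move=> y /set_mem[Iy sy]; exact: frenet_reparam (ltnW im) Iy sy.
rewrite (eq_on_derive1 oJ fr _ (mem_set Js)).
rewrite (frenet_reparam _ _ im Js.1 Js.2) phis.
have ed' : is_derive (phi (s t)) 1 (frenet g i) (derive1 (frenet g i) t).
  by rewrite phis.
rewrite (is_derive_derive1 (is_derive_comp_col _ _ _ _ _ phid ed')).
rewrite dotZl; congr (_ * _); have r0 := gs_diag_gt0 (fv t It) im.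
apply: canRL (mulfK _) _; first by rewrite gt_eqF.
rewrite mulrC (frenetE _ _ im).
apply: dot_derive1_gram_schmidt (oI) (fv) _ (It) (im) _.
  by move=> k x Ix; exact: derivable_is_derive1 (gs k.+1 x Ix).
by move=> k ki; exact: dot_frenet_eq0 It _ im.
Qed.

End frenet_frame.

(** * The three curvature formulas *)

Theorem theorem3p6 (R : realType) (n : nat) (I : set R) (g : R -> 'cV[R]_n)
    (t0 : R) (hn : (2 <= n)%N) (hg : parametrized_curve I g)
    (hord : has_order I g n.-1) (ht0 : I t0) :
  forall t : R, I t ->
  [/\ (3 <= n)%N ->
        curvature I g t0 1 t
        = Num.sqrt (\det (gram_mx g 2 t)) / enorm (derive1 g t) ^+ 3,
      forall i : nat, (2 <= i <= n - 2)%N ->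
        curvature I g t0 i t
        = Num.sqrt (\det (gram_mx g i.+1 t) * \det (gram_mx g i.-1 t))
          / (enorm (derive1 g t) * \det (gram_mx g i t))
    & curvature I g t0 n.-1 t
      = \det (canonical_mx g t) / (enorm (derive1 g t) * \det (gram_mx g n.-1 t))
        * Num.sqrt (\det (gram_mx g (n - 2) t))].
Proof.
(* The dimension becomes n + 2, so the first n + 1 derivatives are free. *)
case: n hn g hg hord => // -[//|n] _ g hg hord t It.
pose v k := derive1n k.+1 g t.
(* Indices start at 0: [r j] belongs to the derivative of order j + 1, and [P i] is the square root
   of det M_i. *)
pose r j := dot (v j) (gram_schmidt v j).
pose P i := \prod_(j < i) r j.
have fv : free (mkseq v n.+1) := hord t It.
have r0 j : (j <= n)%N -> 0 < r j by move=> jn; exact: gs_diag_gt0 fv jn.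
have P0 i : (i <= n.+1)%N -> 0 < P i.
  move=> i_n; apply: prodr_gt0 => j _; apply: r0.
  by rewrite -ltnS (leq_trans _ i_n).
have detM i : (i <= n.+1)%N -> \det (gram_mx g i t) = P i ^+ 2.
  by move=> i_n; exact: det_gram fv i_n.
have PS i : P i.+1 = P i * r i by rewrite /P big_ord_recr.
have rs0 : r 0%N = enorm (derive1 g t).
  by rewrite /r (gs_diag fv)// /gs_residual big_ord0 subr0.
have curvE i : (i < n)%N ->
    curvature I g t0 i.+1 t = (r 0%N)^-1 * (r i.+1 / r i).
  move=> i_n; rewrite (curvatureE hg hord ht0 i t (ltnW i_n) It) rs0.
  by rewrite (frenetE g i.+1 i_n).
(* The last coefficient pairs with a cross product instead of a Gram-Schmidt vector, so it carries
   the sign of det A and may vanish. *)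
pose d := dot (v n.+1) (cross (\matrix_(i, c) gram_schmidt v c i 0)).
have curv_last : curvature I g t0 n.+1 t = (r 0%N)^-1 * (d / r n).
  by rewrite (curvatureE hg hord ht0 n t (ltnSn n) It) rs0 frenet_lastE.
have detA : \det (canonical_mx g t) = d * P n.+1.
  exact: det_gram_schmidt_cross fv.
have P_0 : P 0%N = 1 by rewrite /P big_ord0.
(* What remains is algebra in [r], [P] and [d], using P (i+1) = P i * r i and positivity. *)
clearbody P r d; have sqrtP i : (i <= n.+1)%N -> Num.sqrt (P i ^+ 2) = P i.
  by move=> i_n; rewrite sqrtr_sqr gtr0_norm ?P0.
rewrite -rs0; split.
- move=> n1; rewrite curvE// detM// sqrtP// !PS P_0.
  by field; rewrite gt_eqF ?r0.
(* After the shift of [i], the claim is r_(i+1) / r_i = P (i+2) * P i / P (i+1)^2, up to the factor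
   1 / r_0. *)
- move=> [|i]//; rewrite !subSS subn0 => /andP[i1 i_n].
  have i_n' : (i <= n)%N by exact: ltnW.
  rewrite curvE// !detM ?ltnS ?leqW//.
  rewrite -exprMn sqrtr_sqr gtr0_norm; last by rewrite mulr_gt0 ?P0 ?ltnS ?leqW.
  rewrite !PS; field.
  by rewrite !gt_eqF ?r0 ?P0 ?leqW.
- rewrite curv_last detA !subSS subn0 (detM n.+1 (leqnn _)) (detM n (leqnSn n)).
  rewrite (sqrtP n (leqnSn n)) PS; field.
  by rewrite !gt_eqF ?r0 ?P0 ?leqW.
Qed.
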